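(* Let $\mathbf{p}=(p_i)_{i\ge1}$ with $p_1=0$, $p_2=1$, $p_i\in(0,1)$ for $i\ge 3$. Suppose $\sum_{j=1}^\infty p_j=\infty$. Then $\varphi_i=\varphi_i(\mathbf{p}):=\lim_{n\to\infty}\mathbb{P}(X_i^{n,\mathbf{p}}=1)$ exists, and $0<\varphi_i<1$ for $i\ge3$.
   Context: Random derangement process: put $q_i=1-p_i$. For $n\ge 2$, $X^{n,\mathbf{p}}=(X^n_{n+1}=1,X^n_n,\dots,X^n_1)$ is the $\{0,1\}$-valued inhomogeneous Markov chain, run in decreasing index and started from $X^n_{n+1}=1$, such that $X^n_n=0$ a.s., $X^n_1=1$ a.s., and for $2\le r\le n-1$: $\mathbb{P}(X^n_r=0\mid X^n_{r+1}=0)=p_r$, $\mathbb{P}(X^n_r=1\mid X^n_{r+1}=0)=q_r$, $\mathbb{P}(X^n_r=0\mid X^n_{r+1}=1)=1$. *)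

(* Defs.v *)
From HB Require Import structures.
From mathcomp Require Import all_boot all_order all_algebra.
From mathcomp Require Import all_classical all_reals all_analysis.

Set Implicit Arguments.
Unset Strict Implicit.
Unset Printing Implicit Defensive.

Import Order.TTheory GRing.Theory Num.Theory.
Import numFieldNormedType.Exports.

Local Open Scope classical_set_scope.
Local Open Scope ring_scope.

(* The values 1 and 0 of the chain are encoded as [true] and [false]. *)

(* Only meaningful when [P B != 0]; every use below is guarded accordingly. *)
Definition cond_prob (d : measure_display) (T : measurableType d)
    (R : realType) (P : probability T R) (A B : set T) : \bar R :=
  (P (A `&` B) / P B)%E.

Definition event_eq (d : measure_display) (T : measurableType d)
    (R : realType) (P : probability T R) (Y : {RV P >-> bool}) (b : bool) :
    set T :=
  [set w | Y w = b].

(* The time index decreases: the past of time [r] is [X n.+1, ..., X r.+1]. *)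
Definition markov_decreasing (d : measure_display) (T : measurableType d)
    (R : realType) (P : probability T R) (n : nat)
    (X : nat -> {RV P >-> bool}) : Prop :=
  forall (r : nat) (x : nat -> bool), (1 <= r <= n)%N ->
    let past := [set w | forall s, (r < s <= n.+1)%N -> X s w = x s] in
    P past != 0%E ->
    cond_prob P (event_eq (X r) (x r)) past =
    cond_prob P (event_eq (X r) (x r)) (event_eq (X r.+1) (x r.+1)).

(* Only [X 1, ..., X n.+1] are constrained; the other [X r] are irrelevant. *)
Record derangement_process (R : realType) (p : nat -> R) (n : nat)
    (d : measure_display) (T : measurableType d) (P : probability T R)
    (X : nat -> {RV P >-> bool}) : Prop := DerangementProcess {
  dp_markov : markov_decreasing n X;
  dp_init : P (event_eq (X n.+1) true) = 1%E;
  dp_first : P (event_eq (X n) false) = 1%E;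
  dp_last : P (event_eq (X 1%N) true) = 1%E;
  dp_trans00 : forall r, (2 <= r <= n.-1)%N ->
    P (event_eq (X r.+1) false) != 0%E ->
    cond_prob P (event_eq (X r) false) (event_eq (X r.+1) false) = (p r)%:E;
  dp_trans01 : forall r, (2 <= r <= n.-1)%N ->
    P (event_eq (X r.+1) false) != 0%E ->
    cond_prob P (event_eq (X r) true) (event_eq (X r.+1) false) = (1 - p r)%:E;
  dp_trans10 : forall r, (2 <= r <= n.-1)%N ->
    P (event_eq (X r.+1) true) != 0%E ->
    cond_prob P (event_eq (X r) false) (event_eq (X r.+1) true) = 1%E
}.

(* Main.v *)
Require Import Defs.
From HB Require Import structures.
From mathcomp Require Import all_boot all_order all_algebra.
From mathcomp Require Import all_classical all_reals all_analysis.
From mathcomp Require Import lra.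

(* Once the chain started at time [n] is known to be at 0, the probability of
   being at 1 satisfies the backward recursion
   [a_n(n) = 0], [a_n(r) = (1 - p_r) (1 - a_n(r+1))].  Two solutions started at
   times [n <= m] differ at time [i] by at most
   [\prod_(i <= j < n) (1 - p_j) <= exp (- \sum_(i <= j < n) p_j)], which tends
   to 0 since the series diverges; hence [a_n(i)] is Cauchy in [n].  The limit
   inherits [phi_i = (1 - p_i) (1 - phi_(i+1))], so [phi_i <= 1 - p_i < 1] and
   then [phi_i > 0]. *)

Set Implicit Arguments.
Unset Strict Implicit.
Unset Printing Implicit Defensive.

Import Order.TTheory GRing.Theory Num.Theory.
Import numFieldNormedType.Exports.

Local Open Scope classical_set_scope.
Local Open Scope ring_scope.

(* Probability that the chain is at 1 at time [i], given that it is at 0 at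
   time [i + k], i.e. [k] steps earlier. *)
Fixpoint hit_prob (R : realType) (p : nat -> R) (k i : nat) : R :=
  if k is k'.+1 then (1 - p i) * (1 - hit_prob p k' i.+1) else 0.

Lemma hit_prob_itv (R : realType) (p : nat -> R) (i k : nat) :
  (forall j, (i <= j)%N -> 0 <= p j <= 1) -> 0 <= hit_prob p k i <= 1.
Proof.
elim: k i => [|k IHk] i hp /=; first by rewrite lexx ler01.
have /andP[p0 p1] := hp i (leqnn i).
have /andP[h0 h1] := IHk i.+1 (fun j ij => hp j (ltnW ij)).
by rewrite mulr_ge0 ?mulr_ile1//; lra.
Qed.

(** Both values obey the same affine recursion, so each step multiplies their difference by
    [- (1 - p i)], and [1 - x <= expR (- x)]. At [k = 0] the first value is 0 and the second lies in
    [0, 1], which gives the bound [expR 0]. *)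
Lemma hit_prob_dist (R : realType) (p : nat -> R) (i k l : nat) :
  (forall j, (i <= j)%N -> 0 <= p j <= 1) ->
  `|hit_prob p k i - hit_prob p (k + l) i| <=
    expR (- \sum_(i <= j < i + k) p j).
Proof.
elim: k i => [|k IHk] i hp /=.
  have /andP[h0 h1] := hit_prob_itv l hp.
  by rewrite addn0 big_geq// oppr0 expR0 add0n sub0r normrN ger0_norm.
have /andP[p0 p1] := hp i (leqnn i).
rewrite big_ltn ?addnS ?ltnS ?leq_addr// opprD expRD -addSn -mulrBr normrM.
apply: ler_pM => //.
  by rewrite ger0_norm ?subr_ge0//; apply: expR_ge1Dx.
rewrite opprB addrC addrA subrK distrC.
exact: IHk (fun j ij => hp j (ltnW ij)).
Qed.

Lemma sum_tail_cvgryy (R : realType) (p : nat -> R) (m i : nat) :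
  (m <= i)%N -> (forall j, (m <= j)%N -> 0 <= p j) ->
  (\sum_(m <= j <oo) (p j)%:E)%E = +oo%E ->
  \sum_(i <= j < i + k) p j @[k --> \oo] --> +oo.
Proof.
move=> mi p0 sumoo.
have Soo : \sum_(m <= j < n) p j @[n --> \oo] --> +oo.
  apply/cvgeryP; under eq_fun do rewrite -sumEFin.
  by rewrite -sumoo; apply: is_cvg_nneseries => j mj _; rewrite lee_fin p0.
apply/cvgryPge => A.
(* The threshold [A] is raised by the finite head of the sum, which cancels below. *)
have [N _ NS] := (cvgryPge _).1 Soo (\sum_(m <= j < i) p j + A).
exists N => // k /= Nk; have := NS (i + k)%N (leq_trans Nk (leq_addl _ _)) => /=.
by rewrite (big_cat_nat mi (leq_addr k i))/= lerD2l.
Qed.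

Lemma is_cvg_hit_prob (R : realType) (p : nat -> R) (i : nat) :
  (forall j, (i <= j)%N -> 0 <= p j <= 1) ->
  \sum_(i <= j < i + k) p j @[k --> \oo] --> +oo ->
  cvgn (fun k => hit_prob p k i).
Proof.
move=> hp sumoo; apply: cauchy_cvg; apply: cauchy_exP => e e0.
have /cvgrPdist_lt/(_ e e0)[N _ Ne] := cvg_comp _ _ sumoo (@cvgr_expR R).
(* The value at [N] serves as centre: every later value stays within [expR] of minus the sum up to
   [i + N], hence within [e]. *)
exists (hit_prob p N i), N => // n /= Nn; rewrite /ball/=.
have := Ne N (leqnn N); rewrite /= sub0r normrN ger0_norm ?expR_ge0//.
by apply: le_lt_trans; rewrite -(subnKC Nn); exact: hit_prob_dist.
Qed.

Lemma lim_hit_prob_rec (R : realType) (p : nat -> R) (i : nat) :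
  cvgn (fun k => hit_prob p k i.+1) ->
  limn (fun k => hit_prob p k i) =
  (1 - p i) * (1 - limn (fun k => hit_prob p k i.+1)).
Proof.
move=> cv; apply/cvg_lim => //; rewrite -(cvg_shiftS (fun k => hit_prob p k i)).
by apply: cvgMr; apply: cvgB => //; exact: cvg_cst.
Qed.

Lemma measurable_event_eq (d : measure_display) (T : measurableType d)
    (R : realType) (P : probability T R) (Y : {RV P >-> bool}) (b : bool) :
  measurable (event_eq Y b).
Proof. by have := measurable_funPTI Y (Y := [set b]); apply. Qed.

Lemma event_eqC (d : measure_display) (T : measurableType d)
    (R : realType) (P : probability T R) (Y : {RV P >-> bool}) (b : bool) :
  event_eq Y (~~ b) = ~` event_eq Y b.
Proof. by apply/seteqP; split=> w; rewrite /event_eq/=; case: b; case: (Y w). Qed.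

Lemma event_eq_split (d : measure_display) (T : measurableType d)
    (R : realType) (P : probability T R) (A : set T) (Y : {RV P >-> bool}) :
  measurable A ->
  P A = (P (A `&` event_eq Y false) + P (A `&` event_eq Y true))%E.
Proof.
move=> mA; rewrite (event_eqC _ true) -setDE.
by rewrite [LHS](measureDI P mA (measurable_event_eq Y true)).
Qed.

(** Removes the guard from the transition laws: when [B] is null, both sides vanish. *)
Lemma cond_prob_mul (d : measure_display) (T : measurableType d)
    (R : realType) (P : probability T R) (A B : set T) (c : R) :
  measurable A -> measurable B ->
  (P B != 0%E -> cond_prob P A B = c%:E) -> P (A `&` B) = (c%:E * P B)%E.
Proof.
move=> mA mB; rewrite /cond_prob; have [PB0 _|PB0 /(_ isT) <-] := eqVneq (P B) 0%E.
  rewrite PB0 mule0.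
  by apply: (subset_measure0 (measurableI _ _ mA mB) mB) => //; exact: subIsetr.
by rewrite -muleA mulVe ?mule1// fin_num_measure.
Qed.

(** Total probability over the state at time [i.+1]: a 1 there forces a 0 at time [i], so only the
    state 0 contributes, with weight [1 - p i]. *)
Lemma derangement_process_hit (R : realType) (p : nat -> R) (n : nat)
    (d : measure_display) (T : measurableType d) (P : probability T R)
    (X : nat -> {RV P >-> bool}) (k i : nat) :
  derangement_process p n X -> (2 <= i)%N -> (i + k)%N = n ->
  P (event_eq (X i) true) = (hit_prob p k i)%:E.
Proof.
move=> dX; have mX r b := measurable_event_eq (X r) b.
elim: k i => [|k IHk] i i2 ikn.
  rewrite (event_eqC _ false) probability_setC// -(addn0 i) ikn (dp_first dX).
  by rewrite subee.
have PB1 := IHk i.+1 (leqW i2) (etrans (addSnnS i k) ikn).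
have PB0 : P (event_eq (X i.+1) false) = (1 - hit_prob p k i.+1)%:E.
  by rewrite (event_eqC _ true) probability_setC// PB1 EFinB.
have irange : (2 <= i <= n.-1)%N by rewrite i2 -ikn addnS leq_addr.
have P10 := cond_prob_mul (mX i true) (mX i.+1 false) (dp_trans01 dX irange).
have P01 := cond_prob_mul (mX i false) (mX i.+1 true) (dp_trans10 dX irange).
(* The transition from 1 to 0 already carries the whole mass of [X i.+1 = 1]; subtracting it, in the
   reals, leaves 0 for two consecutive ones. *)
have P11 : P (event_eq (X i) true `&` event_eq (X i.+1) true) = 0%E.
  have := event_eq_split (X i) (mX i.+1 true).
  rewrite !(setIC (event_eq (X i.+1) true)) P01 mul1e PB1.
  have /fineK <- : P (event_eq (X i) true `&` event_eq (X i.+1) true) \is a fin_num.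
    exact/fin_num_measure/measurableI.
  by rewrite -EFinD => -[/esym/(canRL (addKr _))]; rewrite addNr => ->.
by rewrite (event_eq_split (X i.+1) (mX i true)) P11 adde0 P10 PB0.
Qed.

Theorem lemma5 (R : realType) (p : nat -> R)
  (hp1 : p 1%N = 0) (hp2 : p 2%N = 1)
  (hp : forall i : nat, (3 <= i)%N -> 0 < p i < 1)
  (hsum : (\sum_(1 <= j <oo) (p j)%:E)%E = +oo%E) :
  exists phi : nat -> R,
    (forall (d : nat -> measure_display)
            (T : forall n : nat, measurableType (d n))
            (P : forall n : nat, probability (T n) R)
            (X : forall n : nat, nat -> {RV (P n) >-> bool}),
        (forall n : nat, (2 <= n)%N -> derangement_process p n (X n)) ->
        forall i : nat, (1 <= i)%N ->
          (fun n : nat => P n (event_eq (X n i) true)) @ \oo --> (phi i)%:E) /\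
    (forall i : nat, (3 <= i)%N -> 0 < phi i < 1).
Proof.
have p01 j : (1 <= j)%N -> 0 <= p j <= 1.
  case: j => [//|[|[|j]]] _; rewrite ?hp1 ?hp2 ?lexx ?ler01//.
  by have /andP[/ltW -> /ltW ->] := hp j.+3 isT.
pose L i := limn (fun k => hit_prob p k i).
have cvL i : (1 <= i)%N -> cvgn (fun k => hit_prob p k i).
  move=> i1; apply: is_cvg_hit_prob => [j ij|]; first exact/p01/(leq_trans i1).
  by apply: (sum_tail_cvgryy i1 _ hsum) => j /p01/andP[].
have L01 i : (1 <= i)%N -> 0 <= L i <= 1.
  move=> i1; have h01 k : 0 <= hit_prob p k i <= 1.
    by apply: hit_prob_itv => j ij; exact/p01/(leq_trans i1).
  rewrite limr_ge ?limr_le//; try exact: cvL.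
    by near=> k; have /andP[] := h01 k.
  by near=> k; have /andP[] := h01 k.
have Lrec i : L i = (1 - p i) * (1 - L i.+1) := lim_hit_prob_rec (cvL i.+1 isT).
have L1 i : (3 <= i)%N -> L i < 1.
  move=> i3; have /andP[p0 p1] := hp i i3; have /andP[l0 l1] := L01 i.+1 isT.
  by rewrite Lrec; nra.
(* Transitions are prescribed at times 2 and above; at time 1 the value is fixed by [dp_last]. *)
exists (fun i => if i == 1%N then 1 else L i); split=> [d T P X dX i i1|i i3].
  have [->|i_neq1] := eqVneq i 1%N.
    apply: cvg_near_cst; exists 2%N => // n /= n2.
    exact: dp_last (dX n n2).
  have i2 : (2 <= i)%N by rewrite ltn_neqAle eq_sym i_neq1.
  (* Once [n >= i], time [i] lies [n - i] steps after time [n]; the shift by [i] does not affect the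
     limit. *)
  apply: (@cvg_trans _ ((hit_prob p (n - i) i)%:E @[n --> \oo])).
    apply: near_eq_cvg; exists i => // n /= in_.
    by rewrite (derangement_process_hit (dX n (leq_trans i2 in_)) i2 (subnKC in_)).
  apply: cvg_EFin; first by near=> n.
  by rewrite (cvg_centern i (fun k => hit_prob p k i)); exact: cvL.
have -> : (i == 1%N) = false by case: i i3 => [|[]].
(* Both factors of the recursion are positive: [p i < 1], and [L i.+1 < 1] by [L1] at the next
   index. *)
rewrite L1// andbT Lrec mulr_gt0// subr_gt0; last exact/L1/leqW.
by have /andP[] := hp i i3.
Unshelve. all: by end_near.
Qed.
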